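(* Let $p$ be a prime with $p\leq 73$ and let $q=p^{3}$. Then the projective plane $PG(2,q)$ contains a $2$-fold blocking set of size $2\left(q+\sqrt[3]{q^{2}}+\sqrt[3]{q}+1\right)$.
   Context: A $2$-fold blocking set in $PG(2,q)$ is a set of points meeting every line of $PG(2,q)$ in at least $2$ points. *)

(* Defs.v *)
From HB Require Import structures.
From mathcomp Require Import all_boot all_order all_algebra all_field.

Set Implicit Arguments.
Unset Strict Implicit.
Unset Printing Implicit Defensive.

Import GRing.Theory.
Local Open Scope ring_scope.

(* A subspace is encoded by its canonical generating matrix, hence {vspace _}
   is finite over a finite field; the subType structure used here is the one
   declared in VectorInternalTheory. *)
Section VspaceFinite.
Import VectorInternalTheory.

HB.instance Definition _ (F : finFieldType) (n : nat) :=
  [Countable of {vspace 'rV[F]_n} by <:].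
HB.instance Definition _ (F : finFieldType) (n : nat) :=
  [Finite of {vspace 'rV[F]_n} by <:].

End VspaceFinite.

(* PG(2,F): points and lines are the subspaces of F^3 of vector dimension 1
   and 2, with inclusion as incidence. *)
Definition pg_point (F : finFieldType) : finType :=
  {U : {vspace 'rV[F]_3} | \dim U == 1%N}.

Definition pg_line (F : finFieldType) : finType :=
  {U : {vspace 'rV[F]_3} | \dim U == 2%N}.

Definition incident (F : finFieldType) (P : pg_point F) (l : pg_line F) : bool :=
  (val P <= val l)%VS.

Definition fold_blocking_set (F : finFieldType) (t : nat)
    (B : {set pg_point F}) : Prop :=
  forall l : pg_line F, (t <= #|[set P in B | incident P l]|)%N.

(* Main.v *)
Require Import Defs.
From mathcomp Require Import all_boot all_order all_algebra all_fingroup.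
From mathcomp Require Import all_field all_solvable.
From mathcomp Require Import ring zify.

Set Implicit Arguments.
Unset Strict Implicit.
Unset Printing Implicit Defensive.

Import GRing.Theory Num.Theory.
Local Open Scope ring_scope.

(* Let K = F_p, let f be the Frobenius map of F = F_{p^3} and let T be the
   kernel of the trace F -> K.  By pigeonhole, the points spanned by the nonzero
   vectors of a K-subspace of F^3 of K-dimension 4 meet every line, and there
   are at most p^3 + p^2 + p + 1 of them.  So it suffices to find two such
   subspaces spanning disjoint sets of points, and to add arbitrary points.

   For p odd take {(t, t', f t) : t, t' in T} and
   {(x, y, v y - f x) : x in F, y in K}.  If y = 0, a common point yields c <> 0
   with f c = - c, which contradicts f^3 = 1.  If y <> 0, eliminating x leaves
   f t = - v s f(s) / f(f s) with s = t' in T nonzero; as t has trace 0, it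
   suffices that v s f(s) / f(f s) never has trace 0.  With v = f (f w) this
   says that a binary quartic form on T over K, depending linearly on w, has no
   nontrivial zero.  Such a w is exhibited according to p mod 3.
   For p = 2 take {(x, x^2, y)} and {(x, y, g x^2)} with g not in K. *)

(** * Padding of finite sets and counting of roots *)

Lemma subset_extend (T : finType) (A : {set T}) n :
  (#|A| <= n <= #|T|)%N -> exists2 B : {set T}, A \subset B & #|B| = n.
Proof.
elim: n => [|n IH] /andP[An nT].
  by exists A => //; apply/eqP; rewrite -leqn0.
move: An; rewrite leq_eqVlt => /orP[/eqP <-|]; first by exists A.
rewrite ltnS => An; case: IH => [|B AB Bn]; first by rewrite An ltnW.
have [x xB] : exists x, x \notin B.
  apply/existsP; rewrite -negb_forall; apply: contraL nT => /forallP allB.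
  by rewrite -leqNgt -Bn; apply/subset_leq_card/subsetP => x _; apply: allB.
by exists (x |: B); rewrite ?cardsU1 ?xB ?Bn // (subset_trans AB) ?subsetU1.
Qed.

Lemma card_roots_lt (F : finFieldType) (P : {poly F}) :
  P != 0 -> (#|[set x | root P x]| < size P)%N.
Proof.
move=> P0; rewrite cardE; apply: max_poly_roots => //; last exact: enum_uniq.
by apply/allP => x; rewrite mem_enum inE.
Qed.

(** * Points spanned by sets of vectors *)

Section Points.

Variable F : finFieldType.
Implicit Types (u v : 'rV[F]_3) (U : {set 'rV[F]_3}).

Definition pts U : {set pg_point F} :=
  [set P : pg_point F | [exists u in U, (u != 0) && (u \in val P)]].

Lemma point_of_vec_subproof u : u != 0 -> \dim <[u]>%VS == 1%N.
Proof. by move=> u0; rewrite dim_vline u0. Qed.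

Definition point_of_vec u (u0 : u != 0) : pg_point F :=
  exist _ <[u]>%VS (point_of_vec_subproof u0).

Lemma point_eq_vec (P : pg_point F) u :
  u != 0 -> u \in val P -> val P = <[u]>%VS.
Proof.
move=> u0 uP; apply/esym/eqP; rewrite eqEdim -memvE uP /=.
by rewrite (eqP (valP P)) dim_vline u0.
Qed.

(** If [U] met the plane [V] of the line only in 0, addition would embed the product of [U] and [V]
    into F^3, forcing |U| |F|^2 <= |F|^3. *)
Lemma pts_meets_line U (l : pg_line F) :
    {in U &, forall u v, u - v \in U} -> (#|F| < #|U|)%N ->
  exists2 P, P \in pts U & incident P l.
Proof.
move=> UB ltFU; pose V : {vspace 'rV[F]_3} := val l.
have cV : #|[set v in V]| = (#|F| ^ 2)%N.
  by rewrite cardsE card_vspace (eqP (valP l)).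
pose add (uv : 'rV[F]_3 * 'rV[F]_3) := uv.1 + uv.2.
have [u]: exists2 u, u \in U & (u != 0) && (u \in V).
  apply/exists_inP; apply: contraLR ltFU; rewrite -leqNgt negb_exists.
  move=> /forallP nU; have inj : {in setX U [set v in V] &, injective add}.
    move=> [u v] [u' v']; rewrite !inE /= => /andP[uU vV] /andP[u'U v'V].
    rewrite /add /= => e.
    have e' : u - u' = v' - v.
      by apply/eqP; rewrite subr_eq addrAC [v' + _]addrC -e addrK.
    have := nU (u - u'); rewrite UB //= {2}e' rpredB // andbT negbK subr_eq0.
    by move=> /eqP eu; move: e; rewrite eu => /addrI ->.
  have := max_card [in add @: setX U [set v in V]].
  rewrite (card_in_imset inj) cardsX cV card_mx mul1n (expnS _ 2).
  by rewrite leq_pmul2r ?expn_gt0 ?(ltnW (finRing_gt1 _)).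
move=> uU /andP[u0 uV]; exists (point_of_vec u0).
  by rewrite inE; apply/exists_inP; exists u; rewrite // u0 memv_line.
by rewrite /incident /= -memvE.
Qed.

(** Choose one representative in [U] per point: its multiples by nonzero elements of [K] stay in
    [U], and all of them, over all points, are distinct. *)
Lemma card_pts U (K : {set F}) :
    {in K & U, forall k u, k *: u \in U} ->
  (#|pts U| * #|K :\ 0%R| <= #|U :\ 0%R|)%N.
Proof.
move=> UZ.
(* The default 0 is taken only for points outside [pts U]. *)
pose rep (P : pg_point F) := odflt 0 [pick u in U | (u != 0) && (u \in val P)].
have repP P : P \in pts U -> [/\ rep P \in U, rep P != 0 & rep P \in val P].
  rewrite inE /rep => /existsP ex; case: pickP => [u /and3P[]//|no].
  by case: ex => u; rewrite no.
pose f (x : pg_point F * F) := x.2 *: rep x.1.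
have inj : {in setX (pts U) (K :\ 0) &, injective f}.
  move=> [P k] [Q l]; rewrite !in_setX !in_setD1 /= => /and3P[PU k0 _].
  move=> /and3P[QU l0 _]; rewrite /f /= => e.
  have [_ P0 PP] := repP P PU; have [_ Q0 QQ] := repP Q QU.
  have w0 : k *: rep P != 0 by rewrite scaler_eq0 negb_or k0.
  have PQ : P = Q.
    apply: val_inj; rewrite (point_eq_vec w0 (memvZ _ PP)).
    by rewrite e in w0 *; rewrite (point_eq_vec w0 (memvZ _ QQ)).
  move: e; rewrite PQ; move=> /eqP; rewrite -subr_eq0 -scalerBl scaler_eq0.
  by rewrite (negPf Q0) orbF subr_eq0 => /eqP ->.
rewrite -cardsX -(card_in_imset inj); apply/subset_leq_card/subsetP => w.
case/imsetP=> -[P k]; rewrite in_setX in_setD1 /= => /and3P[PU k0 kK] ->.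
have [rU r0 _] := repP P PU.
by rewrite in_setD1 UZ // scaler_eq0 negb_or k0 r0.
Qed.

Lemma pts_disjoint U1 U2 :
    (forall u1 u2 c, u1 \in U1 -> u2 \in U2 -> c != 0 ->
      u1 = c *: u2 -> u1 = 0) ->
  [disjoint pts U1 & pts U2].
Proof.
move=> dj; apply/pred0Pn => -[P /= /andP[]]; rewrite !inE.
move=> /exists_inP[u1 u1U /andP[u10 u1P]] /exists_inP[u2 u2U /andP[u20 u2P]].
move: u1P; rewrite (point_eq_vec u20 u2P) => /vlineP[c ec].
have c0 : c != 0 by apply: contraNneq u10 => c0; rewrite ec c0 scale0r.
by move: u10; rewrite (dj _ _ _ u1U u2U c0 ec) eqxx.
Qed.

(** The affine points (1 : a : b) suffice; the bound leaves room for padding. *)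
Lemma card_pg_point_ge : (#|F| ^ 2 <= #|pg_point F|)%N.
Proof.
pose v (x : F * F) : 'rV[F]_3 := \row_(j < 3) [:: 1; x.1; x.2]`_j.
have v0 x : v x != 0.
  by apply/eqP => /rowP/(_ 0)/eqP; rewrite !mxE /= oner_eq0.
have inj : injective (fun x => point_of_vec (v0 x)).
  move=> [a b] [a' b'] /(congr1 val) /= e.
  have : v (a, b) \in <[v (a', b')]>%VS by rewrite -e memv_line.
  case/vlineP=> c /rowP ec.
  have := ec 0; rewrite !mxE /= mulr1 => c1.
  have := ec 1; have := ec 2; rewrite !mxE /= -c1 !mul1r.
  by move=> -> ->.
by have := leq_card _ inj; rewrite card_prod mulnn.
Qed.

Lemma fold_blocking_set2 (B1 B2 B : {set pg_point F}) :
    (forall l, exists2 P, P \in B1 & incident P l) ->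
    (forall l, exists2 P, P \in B2 & incident P l) ->
    [disjoint B1 & B2] -> B1 :|: B2 \subset B ->
  fold_blocking_set 2 B.
Proof.
move=> bl1 bl2 dj; rewrite subUset => /andP[/subsetP s1 /subsetP s2] l.
have [P PB Pl] := bl1 l; have [Q QB Ql] := bl2 l.
have PQ : P != Q.
  by apply: contraTneq PB => ->; rewrite (disjointFl dj QB).
have <- : #|[set P; Q]| = 2%N by rewrite cards2 PQ.
apply/subset_leq_card/subsetP => R; rewrite !inE.
by case/orP=> /eqP ->; rewrite ?Pl ?Ql ?(s1 _ PB) ?(s2 _ QB).
Qed.

End Points.

(** * Trace forms on a cubic extension *)

Section CubicExtension.

Variables (F : finFieldType) (p : nat) (f : {rmorphism F -> F}).
Hypotheses (pr_p : prime p) (cardF : #|F| = (p ^ 3)%N).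
Hypothesis fE : forall x, f x = x ^+ p.

Definition fixed_field : {set F} := [set x | f x == x].
Definition cubic_trace x : F := x + f x + f (f x).
Definition trace_zero : {set F} := [set x | cubic_trace x == 0].

Local Notation K := fixed_field.
Local Notation T := trace_zero.

(** * Sizes of the fixed field and of the trace kernel *)

Lemma frobenius3 x : f (f (f x)) = x.
Proof. by rewrite !fE -!exprM -{2}(expf_card x) cardF !expnS muln1 mulnA. Qed.

Lemma frobenius_eq0 x : (f x == 0) = (x == 0).
Proof. exact: fmorph_eq0. Qed.

Lemma trace_zeroP x : reflect (f (f x) = - x - f x) (x \in T).
Proof.
rewrite inE /cubic_trace; apply: (iffP eqP) => [/eqP|->]; last by ring.
by rewrite addrC addr_eq0 opprD => /eqP.
Qed.

Let p_gt1 : (1 < p)%N := prime_gt1 pr_p.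

Lemma size_trinomial (a b c : F) :
  c != 0 -> size (c *: 'X^(p ^ 2) + (b *: 'X^p + a *: 'X)) = (p ^ 2).+1.
Proof.
move=> c0; rewrite size_polyDl size_scale ?size_polyXn //.
apply: leq_ltn_trans (size_polyD _ _) _; rewrite gtn_max ltnS.
apply/andP; split; apply: leq_trans (size_scale_leq _ _) _.
  by rewrite size_polyXn (ltn_exp2l 1).
by rewrite size_polyX; nia.
Qed.

Lemma card_trinomial_roots (a b c : F) :
  c != 0 -> (#|[set x | c * f (f x) + b * f x + a * x == 0 :> F]%R| <= p ^ 2)%N.
Proof.
move=> c0; rewrite -ltnS -(size_trinomial a b c0).
apply: leq_trans (card_roots_lt _); last first.
  by rewrite -size_poly_eq0 size_trinomial.
rewrite ltnS; apply/subset_leq_card/subsetP => x; rewrite !inE rootE.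
rewrite !(hornerD, hornerZ, hornerXn, hornerX) !fE -exprM addrA.
by rewrite mulnn.
Qed.

Lemma card_trace_zero_le : (#|T| <= p ^ 2)%N.
Proof.
apply: leq_trans (card_trinomial_roots 1 1 (oner_neq0 _)).
apply/subset_leq_card/subsetP => x; rewrite !inE !mul1r /cubic_trace.
by rewrite addrC [x + _]addrC addrA.
Qed.

Lemma card_fixed_field_le : (#|K| <= p)%N.
Proof.
have sP : size ('X^p - 'X : {poly F}) = p.+1.
  by rewrite size_polyDl ?size_polyN ?size_polyX size_polyXn // ltnS.
rewrite -ltnS -sP; apply: leq_trans (card_roots_lt _); last first.
  by rewrite -size_poly_eq0 sP.
rewrite ltnS; apply/subset_leq_card/subsetP => x; rewrite !inE rootE.
by rewrite !hornerE fE subr_eq0.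
Qed.

Lemma fixed_fieldP x : reflect (f x = x) (x \in K).
Proof. by rewrite inE; apply: eqP. Qed.

(** The trace takes values in K and its fibres are cosets of T, so [x] is determined by its trace
    and its offset from a chosen element of its fibre. With the upper bounds from root counting,
    this pins down both sizes. *)
Lemma card_le_fixed_trace : (p ^ 3 <= #|K| * #|T|)%N.
Proof.
pose rep y := odflt 0 [pick x | cubic_trace x == y].
have repK x : cubic_trace (rep (cubic_trace x)) = cubic_trace x.
  by rewrite /rep; case: pickP => [z /eqP //|/(_ x)]; rewrite eqxx.
pose g x := (cubic_trace x, x - rep (cubic_trace x)).
have inj : injective g by move=> x y [-> /addIr].
rewrite -cardF -cardsT -(card_imset _ inj) -cardsX.
apply/subset_leq_card/subsetP => _ /imsetP[x _ ->]; rewrite in_setX /=.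
apply/andP; split.
  by apply/fixed_fieldP; rewrite /cubic_trace !rmorphD frobenius3 addrC addrA.
have := repK x; set r := rep _; move: r => r; rewrite /cubic_trace => e.
rewrite inE /cubic_trace !rmorphB -subr_eq0 -(subrr (x + f x + f (f x))) -{2}e.
by apply/eqP; ring.
Qed.

Lemma card_fixed_field : #|K| = p.
Proof.
have := card_le_fixed_trace; have := card_trace_zero_le.
by have := card_fixed_field_le; nia.
Qed.

Lemma card_trace_zero : #|T| = (p ^ 2)%N.
Proof.
have := card_le_fixed_trace; rewrite card_fixed_field.
by have := card_trace_zero_le; nia.
Qed.

(** A polynomial of degree p^2 cannot vanish at p^3 elements. This supplies a nonzero Lagrange
    resolvent. *)
Lemma exists_resolvent a b : exists x, f (f x) + b * f x + a * x != 0.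
Proof.
apply/existsP; rewrite -negb_forall; apply/negP => /forallP x0.
have := card_trinomial_roots a b (oner_neq0 F).
rewrite (_ : [set x | _] = setT); last first.
  by apply/setP => x; rewrite !inE mul1r x0.
by rewrite cardsT cardF leq_exp2l.
Qed.

(* [(s * f s * f (f s)) ^+ 2] times the trace of [w / s ^+ 2]. *)
Definition trace_form w s :=
  w * (f s * f (f s)) ^+ 2 + f w * (f (f s) * s) ^+ 2
    + f (f w) * (s * f s) ^+ 2.

(* On T the form for w = 1 is (s^2 + s t + t^2)^2 with t = f s, and a zero would
   give a primitive cube root of unity t / s in F. *)
Lemma trace_form1_neq0 s :
    ~~ (3 %| p ^ 3 - 1)%N -> 3%:R != 0 :> F -> s \in T -> s != 0 ->
  trace_form 1 s != 0.
Proof.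
move=> n3 ch3 /trace_zeroP e s0; rewrite /trace_form !rmorph1 e.
set t := f s.
have -> : 1 * (t * (- s - t)) ^+ 2 + 1 * ((- s - t) * s) ^+ 2
            + 1 * (s * t) ^+ 2 = (s ^+ 2 + s * t + t ^+ 2) ^+ 2 by ring.
rewrite expf_eq0 /=; apply: contra n3 => /eqP e2.
pose om := t / s.
have om2 : om ^+ 2 + om + 1 = 0.
  by rewrite -(mul0r ((s ^+ 2)^-1)) -e2 /om; field.
have om3 : om ^+ 3 = 1.
  by apply/eqP; rewrite -subr_eq0 -(mulr0 (om - 1)) -om2; apply/eqP; ring.
have om_neq1 : om != 1.
  by apply: contraNneq ch3 => om1; rewrite -om2 om1; apply/eqP; ring.
have : om ^+ (p ^ 3 - 1) * om = om.
  by rewrite -exprSr subn1 prednK ?expn_gt0 ?(ltnW p_gt1) // -cardF expf_card.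
have om0 : om != 0 by rewrite mulf_neq0 ?invr_eq0 // frobenius_eq0.
rewrite -[X in _ = X]mul1r => /(mulIf om0).
rewrite -(expr_mod _ om3) /dvdn.
have: ((p ^ 3 - 1) %% 3 < 3)%N by rewrite ltn_mod.
case: (_ %% 3)%N => [//|[|[|//]]] _.
  by rewrite expr1 => om1; rewrite om1 eqxx in om_neq1.
by move=> omsq; move: om3 om_neq1; rewrite exprS omsq mulr1 => ->; rewrite eqxx.
Qed.

Lemma sum_pow3 om : om ^+ 3 = 1 -> om != 1 -> om ^+ 2 = - 1 - om :> F.
Proof.
move=> om3 om1; apply/eqP; rewrite -subr_eq0.
apply/eqP/(mulfI (_ : om - 1 != 0)).
  by rewrite subr_eq0.
rewrite mulr0.
have -> : (om - 1) * (om ^+ 2 - (- 1 - om)) = om ^+ 3 - 1 by ring.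
by rewrite om3 subrr.
Qed.

(* Artin-Schreier: F = K(d) with f d = d + 1, and T = {c d + a : a, c in K}. *)
Lemma exists_trace_form_char3 : p = 3%N ->
  exists w, forall s, s \in T -> s != 0 -> trace_form w s != 0.
Proof.
move=> p3.
have h3 : 3%:R = 0 :> F.
  have /andP[_ /eqP] : p \in [pchar F] by apply: card_finPcharP cardF pr_p.
  by rewrite p3.
have [d0 d0T d0K] : exists2 d, d \in T & d \notin K.
  apply/exists_inP; rewrite -[X in is_true X]negbK negb_exists_in.
  apply/negP=> /forall_inP TK; have: (#|T| <= #|K|)%N.
    by apply/subset_leq_card/subsetP => x /TK; rewrite negbK.
  by rewrite card_fixed_field card_trace_zero p3.
pose e := f d0 - d0.
have e0 : e != 0 by rewrite subr_eq0; apply: contra d0K => /eqP/fixed_fieldP.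
(* On T, [f (f x - x)] and [f x - x] differ by [- 3 f x]. *)
have step x : x \in T -> f (f x - x) = f x - x.
  move=> /trace_zeroP h; rewrite rmorphB h; apply/eqP; rewrite -subr_eq0.
  by rewrite -(mulr0 (- f x)) -h3; apply/eqP; ring.
have fe : f e = e by apply: step.
pose d := d0 / e.
have fd : f d = d + 1.
  by rewrite /d fmorph_div /= fe -[f d0](subrK d0) -/e mulrDl divff // addrC.
have d3 : d ^+ 3 = d + 1 by rewrite -fd fE p3.
(* This choice turns the form into a quartic in [a] and [c] over F_3 without nontrivial zero. *)
exists (d ^+ 2 - 1) => s sT s0.
pose c := f s - s; have fc : f c = c by apply: step.
pose a := s - c * d.
have fa : f a = a.
  by rewrite /a rmorphB rmorphM fc fd mulrDr mulr1 opprD addrA addrAC /c subKr.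
have sE : s = c * d + a by rewrite /a addrC subrK.
have ca0 : (c != 0) || (a != 0).
  rewrite -negb_and; apply: contra s0 => /andP[/eqP c0 /eqP a0].
  by rewrite sE c0 a0 mul0r addr0.
have fs : f s = s + c by rewrite /c addrC subrK.
have ffs : f (f s) = s - c.
  rewrite fs rmorphD fc fs; apply/eqP; rewrite -subr_eq0.
  by rewrite -(mulr0 c) -h3; apply/eqP; ring.
have small x : f x = x -> [\/ x = 0, x = 1 | x = - 1].
  rewrite fE p3 => /eqP; rewrite -subr_eq0.
  have -> : x ^+ 3 - x = x * ((x - 1) * (x + 1)) by ring.
  by rewrite !mulf_eq0 subr_eq0 addr_eq0 => /or3P[]/eqP ->;
    [constructor 1 | constructor 2 | constructor 3].
have -> : trace_form (d ^+ 2 - 1) s =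
    - (a ^+ 4 + c ^+ 2 * a ^+ 2 + c ^+ 4 + c ^+ 3 * a).
  rewrite /trace_form ffs fs !(rmorphB, rmorphXn, rmorphD, rmorph1, fd) /= sE.
  apply/eqP; rewrite -subr_eq0; apply/eqP.
  have -> : forall x y : F, x - - y = x + y by move=> x y; rewrite opprK.
  (* [E] is one third of the difference of the two sides, expanded over the integers and reduced by
     [d3]. *)
  pose E := d ^+ 2 * a ^+ 4 + 14%:R * d ^+ 2 * c ^+ 2 * a ^+ 2
    + 7%:R * d ^+ 2 * c ^+ 4 + 8%:R * d * c * a ^+ 3 + 22%:R * d * c ^+ 3 * a
    + a ^+ 4 + 14%:R * c ^+ 2 * a ^+ 2 + 7%:R * c ^+ 4
    + 8%:R * d ^+ 2 * c * a ^+ 3 + 22%:R * d ^+ 2 * c ^+ 3 * a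
    + 2%:R * d * a ^+ 4 + 26%:R * d * c ^+ 2 * a ^+ 2 + 6%:R * c * a ^+ 3
    + 10%:R * d * c ^+ 4 + 11%:R * c ^+ 3 * a.
  by rewrite -(mul0r E) -h3 /E; ring: d3.
rewrite oppr_eq0; set S := (X in X != 0).
(* Exhaustive check over the pairs (c, a) other than (0, 0) in F_3. *)
have [->|->] : S = 1 \/ S = - 1; last by rewrite oppr_eq0 oner_eq0.
  move: ca0; rewrite /S.
  case: (small c fc) => ->; case: (small a fa) => ->; rewrite ?eqxx // => _;
    first [ by left; ring
          | by left; apply/eqP; rewrite -subr_eq0 -h3; apply/eqP; ring
          | by right; apply/eqP; rewrite -subr_eq0 -h3; apply/eqP; ring ].
by rewrite oner_eq0.
Qed.

(** * Kummer theory for p = 1 mod 3 *)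

(** Here 3 divides p^3 - 1, so Cauchy's theorem gives a unit of order 3; its p-th power is itself
    because p = 1 mod 3. *)
Lemma exists_cube_root1 : (p %% 3 = 1)%N ->
  exists om : F, [/\ om ^+ 3 = 1, om != 1 & f om = om].
Proof.
move=> p1.
have d3 : (3 %| #|[set: {unit F}]|)%N.
  rewrite card_finField_unit cardF -subn1 -eqn_mod_dvd; last first.
    by rewrite expn_gt0 ltnW.
  by rewrite -modnXm p1.
have [u _ ou] := Cauchy (isT : prime 3) d3.
have om3 : val u ^+ 3 = 1 by rewrite -FinRing.val_unitX -ou expg_order.
exists (val u); split => //.
  apply/eqP => u1; have ug : u = 1%g by apply: val_inj.
  by move: ou; rewrite ug order1.
by rewrite fE -(expr_mod _ om3) p1 expr1.
Qed.

(** Squaring identifies 1 and -1, so on the finite set K it is not injective, hence not onto. *)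
Lemma exists_nonsquare : 2%:R != 0 :> F ->
  exists2 be, be \in K & forall x, x \in K -> x ^+ 2 != be.
Proof.
move=> ch2; have sqK x : x \in K -> x ^+ 2 \in K.
  by move=> /fixed_fieldP fx; apply/fixed_fieldP; rewrite rmorphXn /= fx.
pose sq := [set x ^+ 2 | x in K].
have /subsetPn[be beK nbe] : ~~ (K \subset sq).
  apply/negP => /subset_leq_card leK.
  have: #|sq| == #|K| by rewrite eqn_leq leK leq_imset_card.
  move=> /imset_injP inj.
  have K1 : 1 \in K by apply/fixed_fieldP; rewrite rmorph1.
  have KN1 : - 1 \in K by apply/fixed_fieldP; rewrite rmorphN1.
  have /eqP := inj 1 (- 1) K1 KN1 (esym (sqrrN 1)).
  by rewrite -addr_eq0 (negPf ch2).
exists be => // x xK; apply: contraNneq nbe => <-.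
exact: imset_f.
Qed.

(** The conjugates of [th] and of [th ^+ 2] each sum to 0, since 1 + om + om^2 = 0. *)
Lemma trace_Kummer om th c0 c1 c2 :
    om ^+ 3 = 1 -> om != 1 -> f om = om -> f th = om * th ->
    f c0 = c0 -> f c1 = c1 -> f c2 = c2 ->
  cubic_trace (c0 + c1 * th + c2 * th ^+ 2) = 3%:R * c0.
Proof.
move=> om3 om1 fom fth fc0 fc1 fc2.
have om2 := sum_pow3 om3 om1.
rewrite /cubic_trace !(rmorphD, rmorphM, rmorphXn, fc0, fc1, fc2, fth, fom) /=.
by ring: om2.
Qed.

(* By Kummer theory F = K(th) with n = th ^+ 3 in K.  For s = a th + b th^2 and
   w = w0 + w1 th + th^2 the trace form is 3 n^2 times
   a^4 - 2 w1 a^3 b + 3 w0 a^2 b^2 - 2 n a b^3 + n w1 b^4; w0 and w1 are chosen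
   so that this is A^2 - be B^2 with be a nonsquare.  A nontrivial common zero
   of A and B would make the norm of 1 - be + n th + th^2 vanish. *)
Lemma exists_trace_form_1mod3 : p != 2%N -> (p %% 3 = 1)%N ->
  exists w, forall s, s \in T -> s != 0 -> trace_form w s != 0.
Proof.
move=> p2 p1.
have charp k : prime k -> p != k -> k%:R != 0 :> F.
  move=> prk; apply: contraNneq => k0; have /andP[_] : k \in [pchar F].
    by rewrite inE prk k0 eqxx.
  have chp : p \in [pchar F] by apply: card_finPcharP cardF pr_p.
  by rewrite -(dvdn_pcharf chp) dvdn_prime2.
have ch2 := charp 2%N isT p2.
have ch3 : 3%:R != 0 :> F.
  by apply: charp => //; apply: contra_eqN p1 => /eqP ->.
have [om [om3 om1 fom]] := exists_cube_root1 p1.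
have om2 := sum_pow3 om3 om1.
have [be /fixed_fieldP fbe nsq] := exists_nonsquare ch2.
have be0 : be != 0.
  apply: contraTneq (nsq 0 _); last by apply/fixed_fieldP; rewrite rmorph0.
  by move=> ->; rewrite expr0n eqxx.
(* A Lagrange resolvent is an eigenvector of [f] for the eigenvalue [om]. *)
have [th th0 fth] : exists2 th, th != 0 & f th = om * th.
  have [x x0] := exists_resolvent (om ^+ 2) om; eexists; first exact: x0.
  rewrite !(rmorphD, rmorphM, rmorphXn, fom) /= frobenius3.
  by ring: om3.
pose n := th ^+ 3.
have n0 : n != 0 by rewrite expf_neq0.
have fn : f n = n by rewrite /n rmorphXn /= fth exprMn om3 mul1r.
(* Match the quartic with [A ^+ 2 - be * B ^+ 2], [A] and [B] as below: a^3 b and b^4 give w1 = m /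
   n = - x1, then a b^3 gives [y1], and a^2 b^2 gives w0. *)
pose m := 1 - be; pose x1 := - m / n; pose y1 := (n ^+ 2 - m) / (n * be).
pose w := (x1 ^+ 2 + 2%:R - be * y1 ^+ 2) / 3%:R + m / n * th + th ^+ 2.
have fm : f m = m by rewrite /m rmorphB rmorph1 fbe.
have fx1 : f x1 = x1 by rewrite /x1 fmorph_div rmorphN /= fm fn.
have fy1 : f y1 = y1.
  by rewrite /y1 fmorph_div rmorphM rmorphB rmorphXn /= fm fn fbe.
have om0 : om != 0.
  by apply: contra_eq_neq om3 => ->; rewrite expr0n eq_sym oner_eq0.
have [nE mE x1E y1E] :
  [/\ n = th ^+ 3, m = 1 - be, x1 = - m / n
    & y1 = (n ^+ 2 - m) / (n * be)] by [].
exists w => s /trace_zeroP ffs s0; rewrite {}/w.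
clearbody x1 y1 m n.
(* Coordinates of [s] in the basis 1, th, th^2, read off by resolvents; trace 0 kills the constant
   one. *)
pose a := (s + om ^+ 2 * f s + om * f (f s)) / (3%:R * th).
pose b := (s + om * f s + om ^+ 2 * f (f s)) / (3%:R * th ^+ 2).
have fa : f a = a.
  rewrite /a fmorph_div !(rmorphD, rmorphM, rmorphXn, fom, rmorph_nat) /=.
  rewrite frobenius3 fth.
  have -> : f s + om ^+ 2 * f (f s) + om * s
            = om * (s + om ^+ 2 * f s + om * f (f s)) by ring: om3.
  by field; rewrite om0 th0 ch3.
have fb : f b = b.
  rewrite /b fmorph_div !(rmorphD, rmorphM, rmorphXn, fom, rmorph_nat) /=.
  rewrite frobenius3 fth.
  have -> : f s + om * f (f s) + om ^+ 2 * s
            = om ^+ 2 * (s + om * f s + om ^+ 2 * f (f s)) by ring: om3.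
  by field; rewrite om0 th0 ch3.
have sE : s = a * th + b * th ^+ 2.
  by rewrite /a /b ffs om2; field; rewrite th0 ch3.
clearbody a b.
have ab0 : (a != 0) || (b != 0).
  rewrite -negb_and; apply: contra s0 => /andP[/eqP a0 /eqP b0].
  by rewrite sE a0 b0 !mul0r addr0.
have fs : f s = om * a * th + om ^+ 2 * b * th ^+ 2.
  rewrite sE !(rmorphD, rmorphM, rmorphXn, fa, fb, fth) /=; ring.
have fs' : f (f s) = om ^+ 2 * a * th + om * b * th ^+ 2.
  rewrite fs !(rmorphD, rmorphM, rmorphXn, fa, fb, fth, fom) /=.
  by ring: om3.
pose A := a ^+ 2 + x1 * a * b + b ^+ 2; pose B := y1 * a * b + b ^+ 2.
set w := (X in trace_form X s).
have -> : trace_form w s = 3%:R * (n ^+ 2 * (A ^+ 2 - be * B ^+ 2)).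
  have -> : trace_form w s = cubic_trace (w * (f s * f (f s)) ^+ 2).
    rewrite /trace_form /cubic_trace !(rmorphM, rmorphXn, frobenius3) /=.
    by ring.
  pose w0 := (x1 ^+ 2 + 2%:R - be * y1 ^+ 2) / 3%:R; pose w1 := m / n.
  have fw0 : f w0 = w0.
    rewrite /w0 fmorph_div.
    rewrite !(rmorph_nat, rmorphXn, rmorphB, rmorphD, rmorphM) /=.
    by rewrite fx1 fy1 fbe.
  have fw1 : f w1 = w1 by rewrite /w1 fmorph_div fm fn.
  (* [d0], [d1], [d2] are the coordinates of [(f s * f (f s)) ^+ 2] in the basis 1, th, th^2. *)
  pose d0 := 3%:R * a ^+ 2 * b ^+ 2 * n ^+ 2.
  pose d1 := n * (a ^+ 4 - 2%:R * a * b ^+ 3 * n).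
  pose d2 := n * (b ^+ 4 * n - 2%:R * a ^+ 3 * b).
  have -> : w * (f s * f (f s)) ^+ 2 =
      (w0 * d0 + n * w1 * d2 + n * d1) + (w0 * d1 + w1 * d0 + n * d2) * th
        + (w0 * d2 + w1 * d1 + d0) * th ^+ 2.
    have -> : f s * f (f s) =
        a ^+ 2 * th ^+ 2 - a * b * th ^+ 3 + b ^+ 2 * th ^+ 4.
      by rewrite fs' fs; ring: om2.
    by rewrite /w -/w0 -/w1 /d0 /d1 /d2 nE; ring.
  have fd0 : f d0 = d0.
    by rewrite /d0 !(rmorph_nat, rmorphXn, rmorphM) /= fa fb fn.
  have fd1 : f d1 = d1.
    by rewrite /d1 !(rmorph_nat, rmorphXn, rmorphM, rmorphB) /= fa fb fn.
  have fd2 : f d2 = d2.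
    by rewrite /d2 !(rmorph_nat, rmorphXn, rmorphM, rmorphB) /= fa fb fn.
  rewrite (trace_Kummer om3 om1 fom fth);
    try by rewrite !(fn, fw0, fw1, fd0, fd1, fd2, rmorphD, rmorphM).
  congr (_ * _); rewrite /w0 /w1 /d0 /d1 /d2 /A /B x1E y1E mE; field.
  by rewrite ch3 n0 be0.
apply: mulf_neq0 => //; apply: mulf_neq0; first exact: expf_neq0.
rewrite subr_eq0; apply/negP => /eqP AB.
have AK : f A = A.
  by rewrite /A !(rmorphD, rmorphM, rmorphXn, fa, fb, fx1).
have BK : f B = B.
  by rewrite /B !(rmorphD, rmorphM, rmorphXn, fa, fb, fy1).
(* Otherwise [A / B] would be a square root of [be] in K. *)
have B0 : B = 0.
  apply: contraTeq isT => B0; have /nsq/eqP[] : A / B \in K.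
    by apply/fixed_fieldP; rewrite fmorph_div AK BK.
  by rewrite expr_div_n AB mulfK // expf_neq0.
have A0 : A = 0.
  by move/eqP: AB; rewrite B0 expr0n mulr0 expf_eq0 => /eqP.
have b0 : b != 0.
  apply: contraTneq ab0 => b0; rewrite b0 eqxx orbF negbK.
  have /eqP : a ^+ 2 = 0 by rewrite -A0 /A b0; ring.
  by rewrite expf_eq0.
have ba : b = - (y1 * a).
  have /eqP : b * (b + y1 * a) = 0 by rewrite -B0 /B; ring.
  by rewrite mulf_eq0 (negPf b0) addr_eq0 => /eqP.
have a0 : a != 0.
  by apply: contraNneq b0 => a0; rewrite ba a0 mulr0 oppr0.
have r0 : 1 - x1 * y1 + y1 ^+ 2 = 0.
  have /eqP : a ^+ 2 * (1 - x1 * y1 + y1 ^+ 2) = 0 by rewrite -A0 /A ba; ring.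
  by rewrite mulf_eq0 expf_eq0 (negPf a0) => /eqP.
have : (m + n * th + th ^+ 2) * (m + n * (om * th) + (om * th) ^+ 2)
         * (m + n * (om ^+ 2 * th) + (om ^+ 2 * th) ^+ 2) = 0.
  have -> : 0 = (n * be) ^+ 2 * (1 - x1 * y1 + y1 ^+ 2) by rewrite r0 mulr0.
  transitivity (m ^+ 3 + n ^+ 4 + n ^+ 2 - 3%:R * m * n ^+ 2).
    by rewrite nE; ring: om2.
  by rewrite x1E y1E mE; field; rewrite n0 be0.
pose g := m + n * th + th ^+ 2.
have g0 : g != 0.
  (* If [g = 0], then [g - f g = 0] forces [n = om ^+ 2 * th], which [f] does not fix. *)
  apply/eqP => gz; have : (1 - om) * th * (n - om ^+ 2 * th) = g - f g.
    by rewrite /g !(rmorphD, rmorphM, rmorphXn, fm, fn, fth); ring: om2.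
  rewrite gz rmorph0 subr0 => /eqP; rewrite !mulf_eq0 subr_eq0 eq_sym.
  rewrite (negPf om1) (negPf th0) subr_eq0 /= => /eqP nth; have := fn.
  rewrite nth !(rmorphM, rmorphXn, fom, fth) /= => /eqP.
  rewrite -subr_eq0.
  have -> : om ^+ 2 * (om * th) - om ^+ 2 * th
            = om ^+ 2 * th * (om - 1) by ring.
  rewrite !mulf_eq0 ?expf_eq0 /= (negPf om0) (negPf th0).
  by rewrite subr_eq0 (negPf om1).
have -> : m + n * (om * th) + (om * th) ^+ 2 = f g.
  by rewrite /g !(rmorphD, rmorphM, rmorphXn, fm, fn, fth).
have -> : m + n * (om ^+ 2 * th) + (om ^+ 2 * th) ^+ 2 = f (f g).
  rewrite /g !(rmorphD, rmorphM, rmorphXn, fm, fn, fth, fom) /=; ring.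
by apply/eqP; rewrite !mulf_eq0 !frobenius_eq0 (negPf g0).
Qed.
(** In the remaining case p = 2 mod 3, p^3 - 1 is 1 mod 3, so F has no primitive cube root of unity
    and w = 1 works. *)
Lemma exists_trace_form : p != 2%N ->
  exists w, forall s, s \in T -> s != 0 -> trace_form w s != 0.
Proof.
move=> p2; have [p3|p3] := eqVneq p 3; first exact: exists_trace_form_char3.
have: (p %% 3 < 3)%N by rewrite ltn_mod.
have: (p %% 3 != 0)%N.
  by rewrite -/(3 %| p)%N dvdn_prime2 // eq_sym.
case e: (p %% 3)%N => [|[|[|//]]] // _ _; first exact: exists_trace_form_1mod3.
exists 1 => s; apply: trace_form1_neq0.
  rewrite -eqn_mod_dvd ?expn_gt0 ?(ltnW p_gt1) //.
  by rewrite -modnXm e.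
have chp : p \in [pchar F] by apply: card_finPcharP cardF pr_p.
by rewrite -(dvdn_pcharf chp) dvdn_prime2.
Qed.

(** * Disjoint linear sets of rank 4 *)

Definition vec3 (x y z : F) : 'rV[F]_3 := \row_(j < 3) [:: x; y; z]`_j.

Lemma vec3_inj x y z x' y' z' :
  vec3 x y z = vec3 x' y' z' -> [/\ x = x', y = y' & z = z'].
Proof.
move=> /rowP e; have := e 0; have := e 1; have := e 2.
by rewrite !mxE.
Qed.

Lemma vec3B x y z x' y' z' :
  vec3 x y z - vec3 x' y' z' = vec3 (x - x') (y - y') (z - z').
Proof. by apply/rowP; case=> -[|[|[|//]]] i; rewrite !mxE. Qed.

Lemma vec3Z k x y z : k *: vec3 x y z = vec3 (k * x) (k * y) (k * z).
Proof. by apply/rowP; case=> -[|[|[|//]]] i; rewrite !mxE. Qed.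

Lemma vec3_0 : vec3 0 0 0 = 0.
Proof. by apply/rowP; case=> -[|[|[|//]]] i; rewrite !mxE. Qed.

(** The K-subspaces of K-dimension 4; their size p^4 exceeds |F|, as the pigeonhole argument
    requires. *)
Definition rank4 (U : {set 'rV[F]_3}) :=
  [/\ {in U &, forall u v, u - v \in U},
      {in K & U, forall k u, k *: u \in U} & #|U| = (p ^ 4)%N].

Lemma rank4_param (X Y : {set F}) (phi : F -> F -> 'rV[F]_3) :
    (forall x y x' y', phi x y - phi x' y' = phi (x - x') (y - y')) ->
    (forall k x y, k \in K -> k *: phi x y = phi (k * x) (k * y)) ->
    (forall x y, phi x y = 0 -> x = 0 /\ y = 0) ->
    {in X &, forall x x', x - x' \in X} ->
    {in Y &, forall y y', y - y' \in Y} ->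
    {in K & X, forall k x, k * x \in X} ->
    {in K & Y, forall k y, k * y \in Y} ->
    (#|X| * #|Y| = p ^ 4)%N ->
  rank4 [set phi x y | x in X, y in Y].
Proof.
move=> phiB phiZ phi0 XB YB XZ YZ cXY; split.
- move=> _ _ /imset2P[x y xX yY ->] /imset2P[x' y' x'X y'Y ->].
  by rewrite phiB; apply: imset2_f; [apply: XB | apply: YB].
- move=> k _ kK /imset2P[x y xX yY ->].
  by rewrite phiZ //; apply: imset2_f; [apply: XZ | apply: YZ].
rewrite -cXY -cardsX curry_imset2X card_imset // => -[x y] [x' y'] /= e.
have [] := phi0 (x - x') (y - y'); first by rewrite -phiB e subrr.
by move=> /subr0_eq -> /subr0_eq ->.
Qed.

Lemma fixed_fieldB : {in K &, forall x y, x - y \in K}.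
Proof.
by move=> x y /fixed_fieldP fx /fixed_fieldP fy; rewrite inE rmorphB fx fy.
Qed.

Lemma fixed_fieldM : {in K &, forall x y, x * y \in K}.
Proof.
by move=> x y /fixed_fieldP fx /fixed_fieldP fy; rewrite inE rmorphM fx fy.
Qed.

Lemma trace_zeroB : {in T &, forall x y, x - y \in T}.
Proof.
move=> x y /trace_zeroP fx /trace_zeroP fy; apply/trace_zeroP.
by rewrite !rmorphB fx fy; ring.
Qed.

Lemma trace_zeroZ : {in K & T, forall k x, k * x \in T}.
Proof.
move=> k x /fixed_fieldP fk /trace_zeroP fx; apply/trace_zeroP.
by rewrite !rmorphM !fk fx; ring.
Qed.

(** * The disjoint pair for odd p *)

Definition twisted_set v := [set vec3 x y (v * y - f x) | x in setT, y in K].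

Lemma rank4_twisted v : rank4 (twisted_set v).
Proof.
apply: rank4_param => //.
- by move=> x y x' y'; rewrite vec3B rmorphB; congr vec3; ring.
- by move=> k x y /fixed_fieldP fk; rewrite vec3Z rmorphM fk; congr vec3; ring.
- by move=> x y; rewrite -vec3_0 => /vec3_inj[].
- by move=> *; rewrite in_setT.
- exact: fixed_fieldB.
- by move=> *; rewrite in_setT.
- exact: fixed_fieldM.
by rewrite cardsT cardF card_fixed_field -expnSr.
Qed.

Definition trace_set := [set vec3 t t' (f t) | t in T, t' in T].

Lemma rank4_trace : rank4 trace_set.
Proof.
apply: rank4_param => //.
- by move=> x y x' y'; rewrite vec3B rmorphB.
- by move=> k x y /fixed_fieldP fk; rewrite vec3Z rmorphM fk.
- by move=> x y; rewrite -vec3_0 => /vec3_inj[].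
- exact: trace_zeroB.
- exact: trace_zeroB.
- exact: trace_zeroZ.
- exact: trace_zeroZ.
by rewrite card_trace_zero -expnD.
Qed.

Lemma trace_twisted_disjoint : p != 2%N ->
  exists v, [disjoint pts trace_set & pts (twisted_set v)].
Proof.
move=> p2; have [w wP] := exists_trace_form p2.
have ch2 : 2%:R != 0 :> F.
  have chp : p \in [pchar F] by apply: card_finPcharP cardF pr_p.
  by rewrite -(dvdn_pcharf chp) dvdn_prime2.
exists (f (f w)); apply: pts_disjoint => u1 u2 c.
move=> /imset2P[t s tT sT ->] /imset2P[x y _ /fixed_fieldP fy ->] c0.
rewrite vec3Z => /vec3_inj[tE sE ftE].
have [y0|y0] := eqVneq y 0.
  have s0 : s = 0 by rewrite sE y0 mulr0.
  suff t0 : t = 0 by rewrite t0 s0 rmorph0 vec3_0.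
  apply/eqP; apply: contraNT ch2 => t0; have x0 : x != 0.
    by apply: contraNneq t0 => x0; rewrite tE x0 mulr0.
  have fc : f c = - c.
    apply: (mulIf (_ : f x != 0)); first by rewrite frobenius_eq0.
    by rewrite -rmorphM -tE ftE y0; ring.
  have cN : - c = c.
    by have := frobenius3 c; rewrite fc !rmorphN fc rmorphN opprK fc.
  have /eqP : 2%:R * c = 0 by rewrite -(subrr c) -{3}cN; ring.
  by rewrite mulf_eq0 (negPf c0) orbF.
have s0 : s != 0 by rewrite sE mulf_neq0.
have cE : c = s / y by rewrite sE mulfK.
have xE : x = y * t / s by rewrite tE cE; field; rewrite s0 y0.
have fs0 : f s != 0 by rewrite frobenius_eq0.
have ffs0 : f (f s) != 0 by rewrite frobenius_eq0.
(* The equation for [f t] with denominators cleared; applying [f] twice gives [key1] and [key2], one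
   for each term of the trace of [t]. *)
have key : f t * f (f s) = - (f (f w) * s * f s).
  move: ftE; rewrite cE xE fmorph_div rmorphM fy => e.
  have e' : f t * (s + f s) = f (f w) * s * f s.
    have fts : f t * f s = f (f w) * s * f s - f t * s.
      by rewrite {1}e /=; field; rewrite fs0 y0.
    by rewrite mulrDr fts addrC subrK.
  by rewrite -e' (trace_zeroP _ sT); ring.
have key1 : f (f t) * s = - (w * f s * f (f s)).
  have := congr1 f key; rewrite !(rmorphN, rmorphM) /= !frobenius3 => ->.
  by ring.
have key2 : t * f s = - (f w * f (f s) * s).
  have := congr1 f key1; rewrite !(rmorphN, rmorphM) /= !frobenius3 => ->.
  by ring.
case/negP: (wP s sT s0); apply/eqP.
(* Multiplying the three relations by the missing conjugates of [s] and adding them produces the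
   trace form. *)
have -> : trace_form w s = - (f t + f (f t) + t) * (s * f s * f (f s)).
  transitivity (- (f t * f (f s) * s * f s) - (f (f t) * s * f s * f (f s))
                - (t * f s * f (f s) * s)); last by ring.
  by rewrite key key1 key2 /trace_form; ring.
by rewrite (trace_zeroP _ tT); ring.
Qed.

(** * The disjoint pair for p = 2 *)

Definition graph_set1 := [set vec3 x (f x) y | x in setT, y in K].
Definition graph_set2 g := [set vec3 x y (g * f x) | x in setT, y in K].

Lemma rank4_graph1 : rank4 graph_set1.
Proof.
apply: rank4_param => //.
- by move=> x y x' y'; rewrite vec3B rmorphB.
- by move=> k x y /fixed_fieldP fk; rewrite vec3Z rmorphM fk.
- by move=> x y; rewrite -vec3_0 => /vec3_inj[].
- by move=> *; rewrite in_setT.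
- exact: fixed_fieldB.
- by move=> *; rewrite in_setT.
- exact: fixed_fieldM.
by rewrite cardsT cardF card_fixed_field -expnSr.
Qed.

Lemma rank4_graph2 g : rank4 (graph_set2 g).
Proof.
apply: rank4_param => //.
- by move=> x y x' y'; rewrite vec3B rmorphB; congr vec3; ring.
- by move=> k x y /fixed_fieldP fk; rewrite vec3Z rmorphM fk; congr vec3; ring.
- by move=> x y; rewrite -vec3_0 => /vec3_inj[].
- by move=> *; rewrite in_setT.
- exact: fixed_fieldB.
- by move=> *; rewrite in_setT.
- exact: fixed_fieldM.
by rewrite cardsT cardF card_fixed_field -expnSr.
Qed.

(** At a common point, comparing [f a] with the square of [a] gives [c * f x = y], hence
    [b = g * y]; a nonzero [y] would put [g = b / y] in K. *)
Lemma graph_disjoint : p = 2%N ->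
  exists g, [disjoint pts graph_set1 & pts (graph_set2 g)].
Proof.
move=> p2; have [g gK] : exists g, g \notin K.
  apply/existsP; rewrite -negb_forall; apply/negP => /forallP KT.
  have: (#|F| <= #|K|)%N by rewrite subset_leq_card //; apply/subsetP.
  by rewrite cardF card_fixed_field p2.
have g0 : g != 0.
  by apply: contraNneq gK => ->; apply/fixed_fieldP; rewrite rmorph0.
exists g; apply: pts_disjoint => u1 u2 c.
move=> /imset2P[a b _ bK ->] /imset2P[x y _ yK ->] c0.
rewrite vec3Z => /vec3_inj[aE faE bE].
have cx2 : c * f x = y.
  apply: (mulfI c0); rewrite -faE aE !fE p2; ring.
have bgy : b = g * y by rewrite bE -cx2; ring.
have [y0|y0] := eqVneq y 0.
  have x0 : x = 0.
    by apply/eqP; move/eqP: cx2; rewrite y0 mulf_eq0 (negPf c0) frobenius_eq0.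
  by rewrite aE bgy y0 x0 !(mulr0, rmorph0) vec3_0.
case/negP: gK; apply/fixed_fieldP.
have -> : g = b / y by rewrite bgy mulfK.
by rewrite fmorph_div (fixed_fieldP _ bK) (fixed_fieldP _ yK).
Qed.

(** * Assembly of the 2-fold blocking set *)

Lemma exists_fold_blocking_set2 U1 U2 :
    rank4 U1 -> rank4 U2 -> [disjoint pts U1 & pts U2] ->
  exists2 B : {set pg_point F}, fold_blocking_set 2 B &
    #|B| = (2 * (p ^ 3 + p ^ 2 + p + 1))%N.
Proof.
have ltFU : (#|F| < p ^ 4)%N by rewrite cardF ltn_exp2l.
have cpts U : rank4 U -> (#|pts U| <= p ^ 3 + p ^ 2 + p + 1)%N.
  case=> UB UZ cU; have := card_pts UZ.
  have /card_gt0P[u uU] : (0 < #|U|)%N by rewrite cU expn_gt0 ltnW.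
  have U0 : 0 \in U by rewrite -(subrr u) UB.
  have K0 : 0 \in K by apply/fixed_fieldP; rewrite rmorph0.
  have := cardsD1 0 U; rewrite U0 cU => eU.
  have := cardsD1 0 K; rewrite K0 card_fixed_field => eK.
  (* Here c (p - 1) <= p^4 - 1 = (p - 1)(p^3 + p^2 + p + 1). *)
  move: eU eK; set k := #|K :\ _|; set u' := #|U :\ _|; set c := #|pts U|.
  move=> eU eK; nia.
move=> r1 r2 dj.
have [|B sB cB] :=
  @subset_extend _ (pts U1 :|: pts U2) (2 * (p ^ 3 + p ^ 2 + p + 1)).
  apply/andP; split.
    rewrite mul2n -addnn; apply: leq_trans (leq_card_setU _ _) _.
    by rewrite leq_add ?cpts.
  apply: leq_trans (card_pg_point_ge F); rewrite cardF.
  (* In terms of k = p - 2, the difference of the two sides is a polynomial with nonnegative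
     coefficients. *)
  have [k ->] : exists k, p = k.+2 by exists p.-2; lia.
  nia.
exists B => //; apply: fold_blocking_set2 dj sB => l.
  by case: r1 => UB _ cU; apply: pts_meets_line; rewrite ?cU.
by case: r2 => UB _ cU; apply: pts_meets_line; rewrite ?cU.
Qed.

End CubicExtension.

Theorem theorem4 (p q : nat) (F : finFieldType)
  (hp : prime p) (hp73 : (p <= 73)%N) (hq : q = (p ^ 3)%N)
  (hF : #|F| = q) :
  exists B : {set pg_point F},
    fold_blocking_set 2 B /\
    #|B|%:R = 2 * (q%:R + 3.-root (q%:R ^+ 2) + 3.-root q%:R + 1) :> algC.
Proof.
rewrite {}hq {q} in hF *.
have chp : p \in [pchar F] by apply: card_finPcharP hF hp.
pose f := pFrobenius_aut chp.
have fE x : f x = x ^+ p by exact: pFrobenius_autE.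
have [U1 [U2 [r1 r2 dj]]] : exists U1 U2,
    [/\ rank4 p f U1, rank4 p f U2 & [disjoint pts U1 & pts U2]].
  have [p2|p2] := eqVneq p 2%N.
    have [g dj] := graph_disjoint hp hF fE p2.
    exists (graph_set1 f), (graph_set2 f g).
    by split; [apply: rank4_graph1 | apply: rank4_graph2 |].
  have [v dj] := trace_twisted_disjoint hp hF fE p2.
  exists (trace_set f), (twisted_set f v).
  by split; [apply: rank4_trace | apply: rank4_twisted |].
have [B bB cB] := exists_fold_blocking_set2 hp hF fE r1 r2 dj.
(* Rewriting (p^3)^2 as (p^2)^3 lets both cube roots cancel. *)
exists B; split=> //; rewrite cB !(natrM, natrD, natrX) -exprM mulnC exprM.
by rewrite !exprCK ?exprn_ge0 ?ler0n.
Qed.
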